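(* There is an absolute constant $C>0$ such that the following holds. Let $k,M,N_1,\dots,N_k$ be positive integers and $\varepsilon>0$. Let $g:\prod_{i=1}^k[N_i]\to[M]^k$ be a function that passes the two-query test $\mathcal{T}(\alpha)$ with parameter $\alpha=0.75$ with probability at least $1-\varepsilon$. Then there exist functions $h_i:[N_i]\to[M]$, $i=1,\dots,k$, such that \[\Pr_x\bigl[g(x)=(h_1(x_1),h_2(x_2),\dots,h_k(x_k))\bigr]\ge 1-C\varepsilon,\] where $x$ is uniform in $\prod_i[N_i]$.
   Context: For a positive integer $N$, $[N]=\{0,1,\dots,N\}$. The two-query test $\mathcal{T}(\alpha)$ on $g:\prod_{i=1}^k[N_i]\to[M]^k$: choose $x\in\prod_i[N_i]$ uniformly; independently for each $i$, with probability $\alpha$ set $y_i=x_i$ and put $i$ into the set $A$, and otherwise choose $y_i\in[N_i]$ uniformly; query $g$ at $x$ and $y$; accept iff $g(x)_A=g(y)_A$, i.e. $g(x)_i=g(y)_i$ for all $i\in A$. *)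

(* Defs.v *)
From HB Require Import structures.
From mathcomp Require Import all_boot all_order all_algebra.
From mathcomp Require Import reals.

Set Implicit Arguments.
Unset Strict Implicit.
Unset Printing Implicit Defensive.

Import Order.TTheory GRing.Theory Num.Theory.
Local Open Scope ring_scope.

(* [N] = {0, 1, ..., N} has N + 1 elements. *)
Notation upto N := 'I_N.+1.

Definition grid (k : nat) (N : 'I_k -> nat) : finType :=
  {dffun forall i : 'I_k, upto (N i)}.

Definition uniform_pr (R : realType) (T : finType) (E : pred T) : R :=
  #|[set x | E x]|%:R / #|T|%:R.

Section TwoQueryTest.
Variables (R : realType) (k : nat) (N : 'I_k -> nat).

(* Probability that, given x_i = a, the test decides "i \in A" as b and
   then chooses y_i = c. When b is false, c is uniform and may equal a. *)
Definition coord_pr (alpha : R) (i : 'I_k) (a : upto (N i))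
    (b : bool) (c : upto (N i)) : R :=
  if b then alpha * (c == a)%:R else (1 - alpha) * (#|upto (N i)|%:R)^-1.

(* Joint law of (x, A, y): x is uniform and, given x, the pairs
   (i \in A, y_i) are independent over i. *)
Definition test_pmf (alpha : R) (x : grid N) (A : {set 'I_k}) (y : grid N) : R :=
  (#|grid N|%:R)^-1 * \prod_(i < k) coord_pr alpha (x i) (i \in A) (y i).

Definition test_accepts (M : nat) (g : grid N -> {ffun 'I_k -> upto M})
    (x : grid N) (A : {set 'I_k}) (y : grid N) : bool :=
  [forall i in A, g x i == g y i].

Definition test_pass_pr (M : nat) (alpha : R)
    (g : grid N -> {ffun 'I_k -> upto M}) : R :=
  \sum_(x : grid N) \sum_(A : {set 'I_k})
    \sum_(y : grid N | test_accepts g x A y) test_pmf alpha x A y.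

End TwoQueryTest.

Lemma dffun_distr (R : comNzRingType) (I : finType) (T : I -> finType)
  (F : forall i, T i -> R) :
  \sum_(f : {dffun forall i, T i}) \prod_i F i (f i) = \prod_i \sum_(c : T i) F i c.
Proof.
rewrite (reindex (@dffun_of_fprod I T)) /=; last exact/onW_bij/dffun_of_fprod_bij.
transitivity (\sum_(t : fprod T) \prod_(i in I) (fun i => [ffun c => F i c]) i (t i)).
  by apply: eq_bigr => t _; apply: eq_bigr => i _; rewrite !ffunE.
rewrite (@big_fprod R 0 1 *%R +%R I T (fun i => [ffun c => F i c])).
rewrite -(bigA_distr_big_dep _ (fun i => untag 0 [ffun c => F i c])).
by apply: eq_bigr => i _; rewrite -(big_tag (fun i => [ffun c => F i c])); apply: eq_bigr => c _; rewrite ffunE.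
Qed.
Lemma test_pmf_sum1 (R : realType) k (N : 'I_k -> nat) (alpha : R) :
  \sum_(x : grid N) \sum_(A : {set 'I_k}) \sum_(y : grid N) test_pmf alpha x A y = 1.
Proof.
have g0 : (#|grid N| != 0)%N.
  by apply/eqP => /card0_eq /(_ [ffun i => ord0]).
transitivity (\sum_(x : grid N) (#|grid N|%:R)^-1 : R); last first.
  by rewrite sumr_const -[_ *+ _]mulr_natl mulfV // pnatr_eq0.
apply: eq_bigr => x _.
under eq_bigr => A _ do rewrite -mulr_sumr
   (dffun_distr (fun i c => coord_pr alpha (x i) (i \in A) c)).
rewrite -mulr_sumr -[RHS]mulr1; congr (_ * _).
transitivity (\prod_(i < k) ((alpha : R) + (1 - alpha))); last first.
  by rewrite big1 // => i _; rewrite addrC subrK.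
rewrite bigA_distr; apply: eq_bigr => A _; apply: eq_bigr => i _.
rewrite /coord_pr; case: (i \in A).
  by rewrite -mulr_sumr (bigD1 (x i)) //= eqxx big1 ?addr0 ?mulr1 // => c /negPf->.
by rewrite sumr_const -[_ *+ _]mulr_natl mulrCA mulfV ?mulr1 // card_ord pnatr_eq0.
Qed.

(* Main.v *)
(* Given (A, x_A), the points x and y of the test are independent and uniform in
   the subcube of points extending x_A.  Resampling off A and then off A'
   amounts to resampling off A :&: A', so the rejection probability rej(A) is
   subadditive under intersection; as a 3/4-random set is P :|: Q for uniform
   P, Q, and P = (P :|: Q) :&: (P :|: ~: Q), the average of rej over uniform
   sets is at most 2 eps.

   Let h_i(a) be the plurality of g(x)_i over x_i = a, and bad(x) the set of i
   with g(x)_i <> h_i(x_i), restricted to a set s of coordinates.  Writing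
   {i} = (i |: P) :&: (i |: ~: P) gives Pr[i \in bad] = O(eps) for each i, and,
   applied to the functions recording g(x)_i when bad(x) = {i}, that
   Pr[|bad| = 1] = O(eps + Pr[|bad| >= 2]).  If P splits bad(x), then resampling
   x off P and off ~: P gives two independent points that are both bad (unless
   rejected), so Pr[|bad| >= 2] = O(eps + mu^2) with mu = Pr[bad <> set0].
   Hence mu = O(eps + mu^2): mu is either O(eps) or bounded below.  Adding the
   coordinates to s one at a time increases mu by only O(eps) at each step, so
   it never reaches the second alternative. *)
Require Import Defs.
From mathcomp Require Import all_boot all_order all_algebra.
From mathcomp Require Import reals.
From mathcomp Require Import zify ring lra.

Set Implicit Arguments.
Unset Strict Implicit.
Unset Printing Implicit Defensive.

Import Order.TTheory GRing.Theory Num.Theory.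
Local Open Scope ring_scope.

(** * Resampling coordinates of a uniform point *)

Section Mixing.
Local Open Scope nat_scope.
Variables (k : nat) (N : 'I_k -> nat).
Implicit Types (x y z u v w : grid N) (A P Q : {set 'I_k}).

Definition mix A x u : grid N := [ffun i => if i \in A then x i else u i].

(** Up to the factor [#|grid N| ^ 2], the mean of [f] over the two query points given [A]. Counts in
    [nat] avoid division. *)
Definition pairsum A (f : grid N -> grid N -> nat) : nat :=
  \sum_x \sum_u f x (mix A x u).

Lemma mix_in A x u i : i \in A -> mix A x u i = x i.
Proof. by rewrite ffunE => ->. Qed.

Lemma mix_mix A x u : mix A (mix A x u) (mix A u x) = x.
Proof. by apply/ffunP => i; rewrite !ffunE; case: (i \in _). Qed.

Lemma sum_swap A (f : grid N -> grid N -> nat) :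
  \sum_x \sum_u f (mix A x u) (mix A u x) = \sum_x \sum_u f x u.
Proof.
pose h (p : grid N * grid N) := (mix A p.1 p.2, mix A p.2 p.1).
rewrite !pair_big /= [RHS](reindex_inj (h := h)) //=.
by apply: inv_inj => -[x u]; rewrite /h /= !mix_mix.
Qed.

Lemma sum_mix A (f : grid N -> nat) :
  \sum_x \sum_u f (mix A x u) = #|grid N| * \sum_x f x.
Proof.
rewrite (sum_swap A (fun x _ => f x)) big_distrr.
by apply: eq_bigr => x _; rewrite sum_nat_const.
Qed.

Lemma grid_gt0 : 0 < #|grid N|.
Proof. by apply/card_gt0P; exists [ffun i => ord0]. Qed.

(** Outside [A :&: A'] every coordinate is fresh, so the end point is
    [mix (A :&: A') x (mix A' u v)], where [mix A' u v] is uniform. *)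
Lemma sum_resample_twice A A' (f : grid N -> grid N -> nat) :
  \sum_x \sum_u \sum_v f x (mix A' (mix A x u) v) =
  #|grid N| * pairsum (A :&: A') f.
Proof.
rewrite /pairsum big_distrr; apply: eq_bigr => x _.
rewrite -[RHS](sum_mix A' (fun w => f x (mix (A :&: A') x w))).
apply: eq_bigr => u _; apply: eq_bigr => v _; congr f.
by apply/ffunP => i; rewrite !ffunE inE; case: (i \in A); case: (i \in A').
Qed.

(** The hypothesis is a triangle inequality through the midpoint [y], which is again uniform, so
    that [y] and [z] form a pair for [A']. *)
Lemma pairsum_setI A A' (f1 f2 f3 : grid N -> grid N -> nat) :
    (forall x u v, let y := mix A x u in let z := mix A' y v in
       f3 x z <= f1 x y + f2 y z) ->
  pairsum (A :&: A') f3 <= pairsum A f1 + pairsum A' f2.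
Proof.
move=> f3le; rewrite -(leq_pmul2l grid_gt0) -sum_resample_twice mulnDr.
have -> : #|grid N| * pairsum A f1 =
          \sum_x \sum_u \sum_(v : grid N) f1 x (mix A x u).
  rewrite /pairsum !big_distrr; apply: eq_bigr => x _; rewrite big_distrr.
  by apply: eq_bigr => u _; rewrite sum_nat_const.
rewrite -(sum_mix A (fun y => \sum_v f2 y (mix A' y v))) -big_split.
apply: leq_sum => x _; rewrite -big_split; apply: leq_sum => u _.
by rewrite -big_split; apply: leq_sum => v _; apply: f3le.
Qed.

Lemma pairsum_fst A (f : grid N -> nat) :
  pairsum A (fun x _ => f x) = #|grid N| * \sum_x f x.
Proof.
by rewrite /pairsum big_distrr; apply: eq_bigr => x _; rewrite sum_nat_const.
Qed.

Lemma pairsum_snd A (f : grid N -> nat) :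
  pairsum A (fun _ y => f y) = #|grid N| * \sum_x f x.
Proof. exact: sum_mix. Qed.

Lemma leq_pairsum A (f1 f2 : grid N -> grid N -> nat) :
    (forall x u, f1 x (mix A x u) <= f2 x (mix A x u)) ->
  pairsum A f1 <= pairsum A f2.
Proof. by move=> le12; apply: leq_sum => x _; apply: leq_sum => u _; apply: le12. Qed.

(* [mix P x u] and [mix P v x] are independent, as they share no coordinate. *)
Lemma sum_mix_indep P (b : pred (grid N)) :
  \sum_x \sum_u \sum_v b (mix P x u) * b (mix P v x) =
  #|grid N| * (\sum_x b x) ^ 2.
Proof.
rewrite -(sum_swap P) /= exchange_big /=.
under eq_bigr => u _.
  under eq_bigr => x _.
    under eq_bigr => v _.
      rewrite mix_mix.
      have -> : mix P v (mix P x u) = mix P v u.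
        by apply/ffunP => i; rewrite !ffunE; case: (i \in _).
      over.
    rewrite -big_distrr /=; over.
  rewrite -big_distrl /=; over.
by rewrite -big_distrr exchange_big (sum_mix P b) /= mulnCA mulnn.
Qed.

End Mixing.

(** * Counting sets that contain, separate or split *)

Section Toggle.
Local Open Scope nat_scope.
Variable I : finType.
Implicit Types (i j : I) (P : {set I}) (f : {set I} -> nat).

Definition toggle i P : {set I} := [set j | (j \in P) (+) (j == i)].

Lemma toggleK i : involutive (toggle i).
Proof. by move=> P; apply/setP => j; rewrite !inE -addbA addbb addbF. Qed.

Lemma sum_setU1 i f : \sum_P f (i |: P) = 2 * \sum_(P : {set I} | i \in P) f P.
Proof.
rewrite (bigID (fun P => i \in P)) /= mul2n -addnn; congr (_ + _).
  by apply: eq_bigr => P iP; congr f; apply/setUidPr; rewrite sub1set.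
rewrite [RHS](reindex_inj (can_inj (toggleK i))) /=.
apply: eq_big => [P | P niP]; first by rewrite inE eqxx addbT.
congr f; apply/setP => j; rewrite !inE.
by case: eqP => [-> | _]; rewrite ?addbF // (negPf niP).
Qed.

Lemma sum_setC f : \sum_P f (~: P) = \sum_P f P.
Proof. by rewrite [RHS](reindex_inj (can_inj (@setCK _))). Qed.

(** Toggling [j] exchanges the sets that separate [i] from [j] with those that do not. *)
Lemma card_separating i j : i != j ->
  #|{set I}| = 2 * \sum_(P : {set I}) ((i \in P) (+) (j \in P)).
Proof.
move=> neq_ij; rewrite mul2n -addnn.
rewrite [in X in _ = _ + X](reindex_inj (can_inj (toggleK j))) -big_split /=.
rewrite -sum1_card; apply: eq_bigr => P _; rewrite !inE eqxx (negPf neq_ij).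
by case: (i \in P); case: (j \in P).
Qed.

Definition splits P (B : {set I}) := (B :&: P != set0) && (B :&: ~: P != set0).

Lemma splits_many (B : {set I}) : 1 < #|B| ->
  #|{set I}| <= 2 * \sum_(P : {set I}) splits P B.
Proof.
case/card_gt1P => i [j [iB jB neq_ij]]; rewrite (card_separating neq_ij).
rewrite leq_mul2l /=; apply: leq_sum => P _; rewrite /splits.
have [iP | niP] := boolP (i \in P); have [jP | njP] := boolP (j \in P) => //=.
  by have [-> ->] : B :&: P != set0 /\ B :&: ~: P != set0
    by split; apply/set0Pn; [exists i | exists j]; rewrite !inE ?iB ?jB.
by have [-> ->] : B :&: P != set0 /\ B :&: ~: P != set0
  by split; apply/set0Pn; [exists j | exists i]; rewrite !inE ?iB ?jB.
Qed.

End Toggle.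

(** * Rejection counts and their subadditivity *)

Section Decoding.
Local Open Scope nat_scope.
Variables (k M : nat) (N : 'I_k -> nat) (g : grid N -> {ffun 'I_k -> upto M}).
Implicit Types (x y z u v w : grid N) (A P Q : {set 'I_k}) (i j : 'I_k).

Definition rejects A x y : nat := ~~ test_accepts g x A y.

Definition rej A : nat := pairsum A (rejects A).

(** The unnormalised rejection probability for uniform [A], that is, for the test with parameter
    1/2. *)
Definition total_rej : nat := \sum_A rej A.

Lemma rej_setI A A' : rej (A :&: A') <= rej A + rej A'.
Proof.
apply: pairsum_setI => x u v /=; rewrite /rejects.
case: (boolP (test_accepts g x A _)) => //= /forall_inP accA; last first.
  by case: test_accepts.
case: (boolP (test_accepts g _ A' _)) => //= /forall_inP accA'; last first.
  by case: test_accepts.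
rewrite (_ : test_accepts _ _ _ _) //; apply/forall_inP => i.
by rewrite inE => /andP[iA iA']; rewrite (eqP (accA i iA)) accA'.
Qed.

Lemma total_rej_setU :
  #|{set 'I_k}| * total_rej <= 2 * \sum_P \sum_Q rej (P :|: Q).
Proof.
have /leq_trans-> //: #|{set 'I_k}| * total_rej <=
    \sum_P \sum_Q (rej (P :|: Q) + rej (P :|: ~: Q)).
  rewrite /total_rej big_distrr /=; apply: leq_sum => P _.
  rewrite -sum_nat_const; apply: leq_sum => Q _.
  by rewrite -{1}[P]setU0 -(setICr Q) setUIr rej_setI.
rewrite mul2n -addnn -big_split /=; apply: leq_sum => P _.
by rewrite big_split /= (sum_setC (fun Q => rej (P :|: Q))).
Qed.

Section Single.
Variables (T : eqType) (i : 'I_k) (f : grid N -> T).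

(** Disagreement of [f] obeys the triangle inequality. One factor 2 comes from using both [P] and
    [~: P], the other from [sum_setU1]. *)
Lemma pairsum_single :
  #|{set 'I_k}| * pairsum [set i] (fun x y => f x != f y) <=
  4 * \sum_(P : {set 'I_k} | i \in P) pairsum P (fun x y => f x != f y).
Proof.
pose D P := pairsum P (fun x y => f x != f y).
rewrite [leqRHS](_ : _ = 2 * \sum_P D (i |: P)); last by rewrite sum_setU1 mulnA.
rewrite mul2n -addnn -{2}(sum_setC (fun P => D (i |: P))) -big_split /=.
rewrite -sum_nat_const; apply: leq_sum => P _.
rewrite -{1}[[set i]]setU0 -(setICr P) setUIr; apply: pairsum_setI => x u v /=.
case: (eqVneq (f x) (f (mix (i |: P) x u))) => [-> // | _].
exact: leq_trans (leq_b1 _) (leq_addr _ _).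
Qed.

End Single.

(** * Plurality decoding *)

Definition fibre_count x i : {ffun upto M -> nat} :=
  [ffun a : upto M => #|[set u | g (mix [set i] x u) i == a]|].

(** Resampling hits all points of the fibre equally often. As [fibre_count] is a finite function,
    ties are broken alike throughout a fibre. *)
Definition plurality x i : upto M := [arg max_(a > ord0) fibre_count x i a].

(** Any point above [a] gives the same plurality. The default [ord0] is never reached, since each
    [a] is a coordinate of some point. *)
Definition decode i (a : upto (N i)) : upto M :=
  if [pick x : grid N | x i == a] is Some x then plurality x i else ord0.

Lemma decode_plurality x i : decode (x i) = plurality x i.
Proof.
rewrite /decode; case: pickP => [y /eqP y_i | /(_ x)]; last by rewrite eqxx.
have eq_mix u : mix [set i] y u = mix [set i] x u.
  by apply/ffunP => j; rewrite !ffunE inE; case: eqP => // ->.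
rewrite /plurality (_ : fibre_count y i = fibre_count x i) //.
apply/ffunP => a; rewrite !ffunE; congr #|pred_of_set _|.
by apply/setP => u; rewrite !inE eq_mix.
Qed.

Definition wrong x i : bool := g x i != decode (x i).

(** The value [g x i] differs from the plurality and is no more frequent, so it fills at most half
    of the fibre. *)
Lemma wrong_resample x i : wrong x i ->
  #|grid N| <= 2 * \sum_u (g x i != g (mix [set i] x u) i).
Proof.
rewrite /wrong decode_plurality /plurality.
case: arg_maxnP => // a _ /(_ (g x i) isT) max_a neq_a.
have disj : fibre_count x i a + fibre_count x i (g x i) <= #|grid N|.
  rewrite !ffunE -cardsUI (_ : _ :&: _ = set0) ?cards0 ?addn0 ?max_card //.
  apply/setP => u; rewrite !inE; case: eqP => //= ->.
  by rewrite eq_sym (negPf neq_a).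
have -> : \sum_u (g x i != g (mix [set i] x u) i) = #|grid N| - fibre_count x i (g x i).
  rewrite ffunE -(cardsC [set u | g (mix [set i] x u) i == g x i]) addKn -sum1_card.
  rewrite [RHS]big_mkcond; apply: eq_bigr => u _.
  by rewrite !inE eq_sym; case: eqP.
lia.
Qed.

(** From a point of [S], at least half of the resamplings change [g] at [i], hence [f]. *)
Lemma wrong_count (S : pred (grid N)) (T : eqType) (f : grid N -> T) i :
    (forall x, S x -> wrong x i) ->
    (forall x y, S x -> g x i != g y i -> f x != f y) ->
  #|grid N| * \sum_x S x <= 2 * pairsum [set i] (fun x y => f x != f y).
Proof.
move=> S_wrong S_f; rewrite /pairsum !big_distrr; apply: leq_sum => x _.
have [Sx | nSx] := boolP (S x); last by rewrite /= muln0.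
rewrite /= muln1; apply: leq_trans (wrong_resample (S_wrong x Sx)) _.
rewrite leq_mul2l /=; apply: leq_sum => u _.
by case: (boolP (g x i != _)) => // /(S_f _ _ Sx) ->.
Qed.

Lemma wrong_single i :
  #|{set 'I_k}| * #|grid N| * \sum_x wrong x i <= 8 * total_rej.
Proof.
have le1 := @wrong_count (wrong^~ i) _ (fun x => g x i) i
  (fun _ => id) (fun _ _ _ n => n).
have le2 := pairsum_single i (fun x => g x i).
have le3 : \sum_(P : {set 'I_k} | i \in P) pairsum P (fun x y => g x i != g y i)
           <= total_rej.
  rewrite big_mkcond; apply: leq_sum => P _; case: ifP => // iP.
  apply: leq_pairsum => x u; rewrite /rejects.
  case: (boolP (test_accepts g x P _)) => [/forall_inP/(_ i iP) -> // | _].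
  exact: leq_b1.
nia.
Qed.

(** * Sets of bad coordinates within [s] *)

Variable s : seq 'I_k.

Definition bad x : {set 'I_k} := [set i in s | wrong x i].
Definition nbad : nat := \sum_x (0 < #|bad x|).
Definition nmany : nat := \sum_x (1 < #|bad x|).

Lemma accepts_bad A x y i : test_accepts g x A y -> x i = y i -> i \in A ->
  (i \in bad x) = (i \in bad y).
Proof.
by move=> /forall_inP acc xy iA; rewrite !inE /wrong xy (eqP (acc i iA)).
Qed.

(* If both [mix P x u] and [mix P v x] are accepted against [x], then a
   [bad x] split by [P] makes both of these independent points bad. *)
Lemma nsplit_le P :
  #|grid N| * \sum_x splits P (bad x) <= rej P + rej (~: P) + nbad ^ 2.
Proof.
rewrite -(leq_pmul2l (grid_gt0 N)) 2!mulnDr.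
rewrite -[X in _ <= _ + X](sum_mix_indep P (fun x => 0 < #|bad x|)) /=.
have -> : #|grid N| * rej P =
          \sum_x \sum_u \sum_(v : grid N) rejects P x (mix P x u).
  rewrite /rej /pairsum !big_distrr; apply: eq_bigr => x _; rewrite big_distrr.
  by apply: eq_bigr => u _; rewrite sum_nat_const.
have -> : #|grid N| * rej (~: P) =
          \sum_x \sum_(u : grid N) \sum_v rejects (~: P) x (mix P v x).
  rewrite /rej /pairsum !big_distrr; apply: eq_bigr => x _.
  rewrite sum_nat_const; congr (_ * _); apply: eq_bigr => v _; congr rejects.
  by apply/ffunP => i; rewrite !ffunE inE; case: (i \in P).
have -> : #|grid N| * (#|grid N| * \sum_x splits P (bad x)) =
          \sum_x \sum_(u : grid N) \sum_(v : grid N) splits P (bad x).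
  by rewrite !big_distrr; apply: eq_bigr => x _; rewrite !sum_nat_const.
rewrite -!big_split; apply: leq_sum => x _; rewrite -!big_split.
apply: leq_sum => u _; rewrite -!big_split; apply: leq_sum => v _ /=.
rewrite /rejects.
have [acc1 | //] := boolP (test_accepts g x P _); last by case: splits.
have [acc2 | //] := boolP (test_accepts g x (~: P) _); last by case: splits.
have [/andP[/set0Pn[i] /setIP[i_bad iP] /set0Pn[j] /setIP[j_bad jP]] | //] :=
  boolP (splits P (bad x)).
have [-> ->] // : 0 < #|bad (mix P x u)| /\ 0 < #|bad (mix P v x)|.
split; apply/card_gt0P; [exists i | exists j].
  by rewrite -(accepts_bad acc1) // mix_in.
rewrite -(accepts_bad acc2) // ffunE; move: jP; rewrite inE.
by case: (j \in P).
Qed.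

(** At least half of all [P] split a set with two elements; [nsplit_le] is averaged over [P], and
    [P] and [~: P] contribute the same total. *)
Lemma nmany_le : #|{set 'I_k}| * #|grid N| * nmany <=
  4 * total_rej + 2 * #|{set 'I_k}| * nbad ^ 2.
Proof.
have le1 : #|{set 'I_k}| * nmany <= 2 * \sum_(P : {set 'I_k}) \sum_x splits P (bad x).
  rewrite exchange_big /nmany !big_distrr; apply: leq_sum => x _ /=.
  have [/splits_many|] := ltnP 1 #|bad x|; last by rewrite muln0.
  by rewrite muln1.
have le2 : #|grid N| * \sum_(P : {set 'I_k}) \sum_x splits P (bad x) <=
           2 * total_rej + #|{set 'I_k}| * nbad ^ 2.
  rewrite mul2n -addnn -{2}[total_rej](sum_setC rej).
  rewrite -[X in _ <= _ + X]sum_nat_const -!big_split.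
  by rewrite big_distrr; apply: leq_sum => P _; apply: nsplit_le.
nia.
Qed.

Definition single_value i x : option (upto M) :=
  if bad x == [set i] then Some (g x i) else None.

(** Only the at most two [i] with [bad x] or [bad y] equal to [[set i]] can contribute. If the pair
    is accepted and both bad sets have at most one element, these sets agree on [P], and so do the
    values of [g]. *)
Lemma card_single_value P x y : {in P, forall i, x i = y i} ->
  \sum_(i in P) (single_value i x != single_value i y) <=
  2 * (rejects P x y + (1 < #|bad x|) + (1 < #|bad y|)).
Proof.
move=> xy; have le2 : \sum_(i in P) (single_value i x != single_value i y) <= 2.
  have single_le1 z : \sum_i (bad z == [set i]) <= 1.
    case: (pickP (fun i => bad z == [set i])) => [i /eqP zi | z0].
      rewrite (bigD1 i) //= zi eqxx big1 // => j /negPf ji.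
      by rewrite (inj_eq set1_inj) eq_sym ji.
    by rewrite big1 // => i _; rewrite z0.
  apply: leq_trans (leq_add (single_le1 x) (single_le1 y)).
  rewrite -big_split big_mkcond; apply: leq_sum => i _ /=; case: ifP => // _.
  rewrite /single_value; case: (bad x == _); case: (bad y == _) => //=.
  exact: leq_trans (leq_b1 _) _.
have [acc | rej_xy] := boolP (test_accepts g x P y); last first.
  by apply: leq_trans le2 _; rewrite /rejects rej_xy; lia.
have [|x1] := ltnP 1 #|bad x|; first by lia.
have [|y1] := ltnP 1 #|bad y|; first by lia.
rewrite big1 // => i iP; apply/eqP; rewrite eqb0 negbK /single_value.
have gxy : g x i = g y i by apply/eqP; move/forall_inP: acc; apply.
have bad_single z : #|bad z| <= 1 -> (bad z == [set i]) = (i \in bad z).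
  move=> z1; apply/eqP/idP => [-> | iz]; first by rewrite inE.
  by apply/eqP; rewrite eq_sym eqEcard sub1set iz cards1.
by rewrite !bad_single // (accepts_bad acc (xy i iP)) // gxy.
Qed.

(** Summing over [i] inside each pair lets [card_single_value] give a bound independent of [k]. *)
Lemma nsingle_le : #|{set 'I_k}| * #|grid N| * \sum_x (#|bad x| == 1) <=
  16 * total_rej + 32 * (#|{set 'I_k}| * #|grid N| * nmany).
Proof.
pose D i P := pairsum P (fun x y => single_value i x != single_value i y).
have le1 i : #|{set 'I_k}| * #|grid N| * \sum_x (bad x == [set i]) <=
    8 * \sum_(P : {set 'I_k} | i \in P) D i P.
  have le : #|{set 'I_k}| * D i [set i] <=
      4 * \sum_(P : {set 'I_k} | i \in P) D i P by apply: pairsum_single.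
  have : #|grid N| * \sum_x (bad x == [set i]) <= 2 * D i [set i].
    apply: wrong_count => [x /eqP bx | x y bx].
      by have := set11 i; rewrite -bx inE => /andP[].
    move=> neq; rewrite /single_value bx; case: ifP => // _.
  move: (\sum_x _) (D i [set i]) le => b d; nia.
have -> : \sum_x (#|bad x| == 1) = \sum_i \sum_x (bad x == [set i]).
  rewrite exchange_big; apply: eq_bigr => x _ /=.
  have [/cards1P[i ->] | x1] := boolP (#|bad x| == 1).
    rewrite (bigD1 i) //= eqxx big1 // => j /negPf ji.
    by rewrite (inj_eq set1_inj) eq_sym ji.
  by rewrite big1 // => i _; apply/eqP; rewrite eqb0; apply: contraNneq x1 => ->; rewrite cards1.
have le2 : \sum_i \sum_(P : {set 'I_k} | i \in P) D i P <=
    2 * (total_rej + 2 * (#|{set 'I_k}| * #|grid N| * nmany)).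
  rewrite (exchange_big_dep predT) //=.
  have -> : 2 * (#|{set 'I_k}| * #|grid N| * nmany) =
    \sum_(P : {set 'I_k}) (pairsum P (fun x _ => 1 < #|bad x|) + pairsum P (fun _ y => 1 < #|bad y|)).
    under eq_bigr do rewrite pairsum_fst pairsum_snd -/nmany.
    by rewrite sum_nat_const addnn -mul2n [RHS]mulnCA -mulnA.
  rewrite -big_split big_distrr; apply: leq_sum => P _ /=.
  rewrite /D /rej /pairsum exchange_big -!big_split big_distrr.
  apply: leq_sum => x _ /=; rewrite exchange_big -!big_split big_distrr.
  apply: leq_sum => u _; apply: leq_trans (card_single_value _) _ => [i iP|].
    by rewrite mix_in.
  by rewrite -addnA.
rewrite big_distrr; apply: leq_trans (leq_sum _ (fun i _ => le1 i)) _.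
rewrite -big_distrr; apply: leq_trans (leq_mul (leqnn 8) le2) _; lia.
Qed.

(** The inequality mu = O(eps + mu^2), with 148 = 16 + 33 * 4 and 66 = 33 * 2. *)
Lemma nbad_le : #|{set 'I_k}| * #|grid N| * nbad <=
  148 * total_rej + 66 * (#|{set 'I_k}| * nbad ^ 2).
Proof.
have {1}-> : nbad = \sum_x (#|bad x| == 1) + nmany.
  by rewrite -big_split; apply: eq_bigr => x _; case: #|bad x| => [|[]].
by have := nmany_le; have := nsingle_le; lia.
Qed.

End Decoding.

(** * From the law of the test to counts *)

Section TestLaw.
Variables (R : realType) (k M : nat) (N : 'I_k -> nat).
Variable g : grid N -> {ffun 'I_k -> upto M}.

Lemma prod_indicator (I : finType) (b : pred I) :
  \prod_i (b i)%:R = [forall i, b i]%:R :> R.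
Proof.
have [/forallP b_true | /forallPn[i /negPf b_i]] := boolP [forall i, b i].
  by rewrite big1 // => i _; rewrite b_true.
by rewrite (bigD1 i) //= b_i mul0r.
Qed.

Lemma sum_delta (T : finType) (z : T) (f : T -> R) :
  \sum_y f y * (z == y)%:R = f z.
Proof.
rewrite (bigD1 z) //= eqxx mulr1 big1 ?addr0 // => y /negPf.
by rewrite eq_sym => ->; rewrite mulr0.
Qed.

Lemma setU_law (A : {set 'I_k}) :
  \sum_(P : {set 'I_k}) \sum_(Q : {set 'I_k}) (P :|: Q == A)%:R =
  \prod_i (if i \in A then 3 else 1) :> R.
Proof.
transitivity (\prod_i ((i \in A)%:R *+ 2 + 1) : R); last first.
  by apply: eq_bigr => i _; case: (i \in A) => /=; ring.
rewrite bigA_distr; apply: eq_bigr => P _.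
(* For [i \in P] both choices for [Q] are allowed exactly when [i \in A]; for [i \notin P]
   membership in [Q] is forced. *)
transitivity (\prod_i ((i \in A)%:R + ((i \in P) == (i \in A))%:R) : R); last first.
  apply: eq_bigr => i _; case: (i \in P); case: (i \in A) => //=;
  by rewrite ?addr0 ?add0r.
rewrite bigA_distr; apply: eq_bigr => Q _.
rewrite (eq_bigr (fun i => ((i \in P :|: Q) == (i \in A))%:R)); last first.
  by move=> i _; rewrite inE; case: (i \in P); case: (i \in Q); case: (i \in A).
rewrite prod_indicator; congr (_%:R); congr (nat_of_bool _).
by apply/eqP/forallP => [-> // | eqA]; apply/setP => i; apply/eqP.
Qed.

(** On [A] the point [u] is free but [y] must equal [x]; off [A], [u] must equal [y]. *)
Lemma mix_law (A : {set 'I_k}) (x y : grid N) :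
  \sum_u (mix A x u == y)%:R =
  \prod_i (if i \in A then (#|upto (N i)|)%:R * (y i == x i)%:R else 1) :> R.
Proof.
pose F i (c : upto (N i)) : R := ((if i \in A then x i else c) == y i)%:R.
transitivity (\prod_i \sum_(c : upto (N i)) F i c); last first.
  apply: eq_bigr => i _; rewrite /F; case: (i \in A).
    by rewrite sumr_const mulr_natl eq_sym.
  by rewrite -[RHS](sum_delta (y i) (fun=> 1)); apply: eq_bigr => c _; rewrite mul1r eq_sym.
rewrite -dffun_distr; apply: eq_bigr => u _; rewrite prod_indicator.
congr (_%:R); congr (nat_of_bool _).
apply/eqP/forallP => [<- i | eqy]; first by rewrite ffunE.
by apply/ffunP => i; rewrite ffunE; apply/eqP.
Qed.

Lemma card_grid : #|grid N|%:R = \prod_i #|upto (N i)|%:R :> R.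
Proof.
rewrite -sum1_card natr_sum.
transitivity (\prod_i \sum_(c : upto (N i)) (1 : R)); last first.
  by apply: eq_bigr => i _; rewrite sumr_const.
by rewrite -dffun_distr; apply: eq_bigr => u _; rewrite big1.
Qed.

(* A set containing each [i] independently with probability 3/4 is the union
   of two independent uniform sets. *)
Lemma test_pmf_law (x y : grid N) (A : {set 'I_k}) :
  (#|{set 'I_k}|%:R * #|grid N|%:R) ^+ 2 * test_pmf (3 / 4) x A y =
  (\sum_u (mix A x u == y)%:R) *
  (\sum_(P : {set 'I_k}) \sum_(Q : {set 'I_k}) (P :|: Q == A)%:R) :> R.
Proof.
rewrite mix_law setU_law -big_split /test_pmf /=.
have n0 : #|grid N|%:R != 0 :> R by rewrite pnatr_eq0 -lt0n grid_gt0.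
have -> : (#|{set 'I_k}|%:R * #|grid N|%:R) ^+ 2 *
    (#|grid N|%:R^-1 * \prod_(i < k) coord_pr (3 / 4) (x i) (i \in A) (y i)) =
    #|{set 'I_k}|%:R ^+ 2 * #|grid N|%:R *
    \prod_(i < k) coord_pr (3 / 4) (x i) (i \in A) (y i) :> R.
  by field.
have -> : #|{set 'I_k}|%:R ^+ 2 = \prod_(i < k) 4 :> R.
  by rewrite prodr_const card_ord -cardsT -powersetT card_powerset cardsT card_ord natrX exprAC -natrX.
rewrite card_grid -!big_split; apply: eq_bigr => i _ /=.
have ni0 : #|upto (N i)|%:R != 0 :> R by rewrite card_ord pnatr_eq0.
rewrite /coord_pr; case: (i \in A); last by field.
by field.
Qed.

Lemma reject_pr :
  (#|{set 'I_k}|%:R * #|grid N|%:R) ^+ 2 * (1 - test_pass_pr (3 / 4) g) =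
  (\sum_(P : {set 'I_k}) \sum_(Q : {set 'I_k}) rej g (P :|: Q))%:R :> R.
Proof.
have -> : 1 - test_pass_pr (3 / 4) g =
    \sum_(x : grid N) \sum_(A : {set 'I_k}) \sum_(y : grid N)
      (rejects g A x y)%:R * test_pmf (3 / 4) x A y :> R.
  apply: (canLR (addrK _)); rewrite -[LHS](test_pmf_sum1 N (3 / 4)) -big_split.
  apply: eq_bigr => x _; rewrite -big_split; apply: eq_bigr => A _ /=.
  rewrite [X in _ + X]big_mkcond -big_split; apply: eq_bigr => y _ /=.
  by rewrite /rejects; case: (test_accepts g x A y) => /=; ring.
(* Both sides are grouped by the value [A] of [P :|: Q]. *)
pose rejR A : R := (rej g A)%:R.
transitivity (\sum_(A : {set 'I_k}) rejR A *
    \sum_(P : {set 'I_k}) \sum_(Q : {set 'I_k}) (P :|: Q == A)%:R).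
  rewrite exchange_big mulr_sumr; apply: eq_bigr => A _ /=.
  rewrite /rejR /rej natr_sum mulr_suml mulr_sumr; apply: eq_bigr => x _.
  rewrite natr_sum mulr_sumr.
  rewrite (eq_bigr _ (fun y _ => mulrCA _ (rejects g A x y)%:R _)).
  rewrite (eq_bigr _ (fun y _ => congr1 _ (test_pmf_law x y A))).
  rewrite (eq_bigr _ (fun y _ => mulrA _ _ _)) -mulr_suml; congr (_ * _).
  rewrite (eq_bigr _ (fun y _ => mulr_sumr _ _ _ _)) exchange_big.
  by apply: eq_bigr => u _; rewrite sum_delta.
under eq_bigr do rewrite mulr_sumr.
rewrite exchange_big natr_sum; apply: eq_bigr => P _ /=.
under eq_bigr do rewrite mulr_sumr.
rewrite exchange_big natr_sum; apply: eq_bigr => Q _ /=.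
exact: sum_delta.
Qed.

(** * Bounding the number of bad points by induction on [s] *)

Lemma total_rej_le (eps : R) : 1 - eps <= test_pass_pr (3 / 4) g ->
  (total_rej g)%:R <= 2 * eps * #|{set 'I_k}|%:R * #|grid N|%:R ^+ 2.
Proof.
move=> pass; have := total_rej_setU g; rewrite -(ler_nat R) !natrM -reject_pr.
set K := #|{set 'I_k}|%:R; set n := #|grid N|%:R => le_rej.
have K0 : 0 < K by rewrite ltr0n; apply/card_gt0P; exists set0.
rewrite -(ler_pM2l K0); apply: le_trans le_rej _.
have -> : K * (2 * eps * K * n ^+ 2) = 2 * ((K * n) ^+ 2 * eps) by ring.
by rewrite ler_pM2l // ler_wpM2l ?sqr_ge0 //; lra.
Qed.

Lemma nbad_small (eps : R) (s : seq 'I_k) : 10 ^+ 5 * eps <= 1 ->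
    1 - eps <= test_pass_pr (3 / 4) g ->
  (nbad g s)%:R <= 592 * eps * #|grid N|%:R.
Proof.
move=> eps_le pass; have := total_rej_le pass.
set K := #|{set 'I_k}|%:R; set n := #|grid N|%:R; set F := _%:R => F_le.
have K0 : 0 < K by rewrite ltr0n; apply/card_gt0P; exists set0.
have n0 : 0 < n by rewrite ltr0n grid_gt0.
have eps0 : 0 <= eps.
  have F0 : 0 <= F by rewrite ler0n.
  have := le_trans F0 F_le; rewrite pmulr_lge0 ?exprn_gt0 // pmulr_lge0 //.
  by rewrite pmulr_rge0.
elim: s => [|i s IHs].
  rewrite /nbad big1 => [|x _]; first by rewrite !mulr_ge0 // ltW.
  by rewrite (_ : bad _ _ _ = set0) ?cards0 //; apply/setP => i; rewrite !inE.
have step : (nbad g (i :: s) <= nbad g s + \sum_x wrong g x i)%N.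
  rewrite /nbad -big_split; apply: leq_sum => x _ /=.
  have [/card0_eq bad0 | _] := posnP #|bad g s x|; last by case: (0 < _)%N.
  have [| right_i] := boolP (wrong g x i); first by case: (0 < _)%N.
  rewrite (_ : bad g (i :: s) x = set0) ?cards0 //; apply/setP => j.
  have := bad0 j; rewrite !inE; case: eqP => // -> _.
  by rewrite (negPf right_i) andbF.
have wrong_le : (\sum_x wrong g x i)%:R <= 16 * eps * n.
  have := wrong_single g i; rewrite -(ler_nat R) !natrM -/K -/n -/F => le_F.
  have Kn0 : 0 < K * n by rewrite mulr_gt0.
  rewrite -(ler_pM2l Kn0); apply: le_trans le_F _.
  have -> : K * n * (16 * eps * n) = 8 * (2 * eps * K * n ^+ 2) by ring.
  by rewrite ler_pM2l.
move: step; rewrite -(ler_nat R) natrD => step.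
have := nbad_le g (i :: s).
rewrite -(ler_nat R) natrD !natrM -/K -/n -/F.
move: (nbad g (i :: s))%:R (ler0n R (nbad g (i :: s))) step => m m0 step le_m.
(* One new coordinate gives at most [(592 + 16) * eps * n], and 608 / 10^5 < 1 / 132: the large
   alternative is excluded. *)
have m_small : m <= n / 132.
  by apply: le_trans step _; nra.
have le1 : K * (n * m) <= K * (296 * eps * n ^+ 2 + 66 * m ^+ 2) by lra.
rewrite ler_pM2l // in le1.
(* Now [66 * m ^+ 2] is at most half of [n * m] and is absorbed on the left, which leaves 592 = 2 *
   296. *)
have le2 : m ^+ 2 <= n / 132 * m by rewrite expr2 ler_wpM2r.
rewrite -(ler_pM2l n0); lra.
Qed.

End TestLaw.

(** * The decoding theorem *)

Theorem theorem2p5 (R : realType) :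
  exists C : R, 0 < C /\
    forall (k M : nat) (N : 'I_k -> nat) (eps : R)
           (g : grid N -> {ffun 'I_k -> upto M}),
      (0 < k)%N -> (0 < M)%N -> (forall i, (0 < N i)%N) -> 0 < eps ->
      1 - eps <= test_pass_pr (3 / 4) g ->
      exists h : forall i : 'I_k, upto (N i) -> upto M,
        1 - C * eps <=
          uniform_pr R (fun x : grid N => g x == [ffun i => h i (x i)]).
Proof.
exists (10 ^+ 5); split=> [|k M N eps g _ _ _ eps0 pass]; first by rewrite exprn_gt0.
exists (@decode k M N g); rewrite /uniform_pr.
have n0 : 0 < #|grid N|%:R :> R by rewrite ltr0n grid_gt0.
(* For larger [eps] the claimed lower bound is negative. *)
have [eps_le | eps_gt] := leP (10 ^+ 5 * eps) 1; last first.
  apply: le_trans (divr_ge0 (ler0n _ _) (ler0n _ _)); lra.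
rewrite ler_pdivlMr //.
have := nbad_small (enum 'I_k) eps_le pass; have := mulr_gt0 eps0 n0.
(* With [s] listing all coordinates, decoding fails at [x] exactly when its bad set is nonempty. *)
have -> : #|grid N| = (#|[set x | g x == [ffun i => decode g (x i)]]| + nbad g (enum 'I_k))%N.
  rewrite -sum1_card /nbad -sum1_card [X in (X + _)%N]big_mkcond -big_split.
  apply: eq_bigr => x _; rewrite inE.
  have [/eqP right_x | wrong_x] := eqVneq.
    rewrite (_ : bad _ _ _ = set0) ?cards0 //; apply/setP => i.
    by rewrite !inE /wrong (eqP right_x) ffunE eqxx andbF.
  suff -> : (0 < #|bad g (enum 'I_k) x|)%N by [].
  have /forallPn[i wrong_i] : ~~ [forall i, g x i == decode g (x i)].
    apply: contra wrong_x => /forallP right_x.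
    by apply/eqP/ffunP => i; rewrite ffunE; apply/eqP.
  by apply/card_gt0P; exists i; rewrite inE mem_enum.
rewrite natrD; lra.
Qed.
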